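(* Let $\delta>0$ and $m_2>0$. Among all linear and nonlinear operators $T:L^\infty(\mathbb{R})\to L^\infty(\mathbb{R})$, the operator $$(L_\delta g)(x):=\frac{g(x+h(\delta))-g(x-h(\delta))}{2h(\delta)},\qquad h(\delta)=\sqrt{\frac{2\delta}{m_2}},$$ yields the best approximation of $f'$ for $f\in\mathcal{K}(\delta,m_2)$, and $$\gamma_2:=\inf_T\ \sup\ \|Tf_\delta-f'\|_\infty=\sqrt{2\delta m_2},$$ where the supremum is over all pairs $(f,f_\delta)$ with $f_\delta\in L^\infty(\mathbb{R})$ and $f\in\mathcal{K}(\delta,m_2)$, and the infimum is over all (linear and nonlinear) operators $T:L^\infty(\mathbb{R})\to L^\infty(\mathbb{R})$. That is, the infimum equals $\sqrt{2\delta m_2}$ and it is attained at $T=L_\delta$.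
   Context: $\|\cdot\|_\infty$ is the $L^\infty(\mathbb{R})$ norm (essential supremum). Given $f_\delta\in L^\infty(\mathbb{R})$ (noisy data), $\mathcal{K}(\delta,m_2)$ is the set of all real-valued functions $f\in C^2(\mathbb{R})$ with $\|f''\|_\infty\le m_2$ and $\|f-f_\delta\|_\infty\le\delta$. Operators $T$ are arbitrary maps and may depend on $\delta$ and $m_2$. *)

(* Defs.v *)
From HB Require Import structures.
From mathcomp Require Import all_boot all_order all_algebra.
From mathcomp Require Import all_classical all_reals all_analysis.
From mathcomp Require Import measurable_realfun ess_sup_inf.

Set Implicit Arguments.
Unset Strict Implicit.
Unset Printing Implicit Defensive.

Import Order.TTheory GRing.Theory Num.Theory.
Import numFieldNormedType.Exports.

Local Open Scope classical_set_scope.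
Local Open Scope ring_scope.

(* Elements of [Linfty R] are almost-everywhere classes of real functions; the
   coercion to functions picks a representative. *)
Definition Linfty (R : realType) := LspaceType (@lebesgue_measure R) (leey 1).

Definition normLinfty (R : realType) (f : R -> R) : \bar R :=
  'N[@lebesgue_measure R]_+oo [EFin \o f]%E.

Section translation.
Context {R : realType}.
Local Notation mu := (@lebesgue_measure R).

Let translate (c : R) : measurableTypeR R -> measurableTypeR R :=
  fun x => x + c.

Let measurable_translate c :
  measurable_fun [set: measurableTypeR R] (translate c).
Proof.
by apply: (@continuous_measurable_fun R) => x; apply: cvgD => //; exact: cvg_cst.
Qed.

Lemma lebesgue_measure_preim_addr (c : R) (A : set (measurableTypeR R)) :
  measurable A -> mu ((fun x => x + c) @^-1` A) = mu A.
Proof.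
move=> mA; apply/esym.
apply: (lebesgue_measure_unique (mu := pushforward mu (translate c))) => //=.
move=> _ [[a b]] _ <-; rewrite /pushforward.
rewrite (_ : _ @^-1` _ = `]a - c, b - c]%classic); last first.
  by apply/seteqP; split => x /=; rewrite /translate !in_itv/= ltrBlDr lerBrDr.
rewrite !lebesgue_measure_itv/= !lte_fin ltrD2r; case: ifPn => // _.
by rewrite -!EFinB opprB addrA subrK.
Qed.

Lemma ae_translate (c : R) (P : R -> Prop) :
  (\forall x \ae mu, P x) -> \forall x \ae mu, P (x + c).
Proof.
move=> [A [mA A0 PA]]; exists (translate c @^-1` A); split.
- by rewrite -[X in measurable X]setTI; exact: measurable_translate.
- by have := lebesgue_measure_preim_addr c mA; rewrite A0.
- by move=> x /= Px; exact: PA.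
Qed.

End translation.

Section Linfty_classes.
Context d (T : measurableType d) (R : realType).
Variable mu : {measure set T -> \bar R}.
Local Open Scope quotient_scope.

Definition mfun_class (f : {mfun T >-> measurableTypeR R}) :
  {mfun_ mu, T >-> measurableTypeR R} := \pi f.

Lemma ae_mfun_class (f : {mfun T >-> measurableTypeR R}) :
  (mfun_class f : T -> R) = f %[ae mu].
Proof. by have /eqmodP/asboolP := reprK (mfun_class f). Qed.

Lemma ae_eq_setT (f g : T -> R) :
  f = g %[ae mu] -> \forall x \ae mu, f x = g x.
Proof. by apply: filterS => x /(_ I). Qed.

Lemma ae_eq_Lnormy (f g : T -> R) : f = g %[ae mu] ->
  ('N[mu]_+oo[EFin \o f] = 'N[mu]_+oo[EFin \o g])%E.
Proof.
move=> fg; rewrite unlock; case: ifPn => // _; apply: eq_ess_sup.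
by apply: filterS (ae_eq_setT fg) => x /= ->.
Qed.

Section Linfty_class.
Variables (f : T -> measurableTypeR R) (mf : measurable_fun setT f).
Hypothesis f_fin : finite_norm mu +oo%E f.

Let cls := mfun_class (mfun_Sub (mem_set mf)).

Let finite_norm_cls : finite_norm mu +oo%E cls.
Proof. by rewrite /finite_norm (ae_eq_Lnormy (ae_mfun_class _)). Qed.

Definition Linfty_class : LspaceType mu (leey 1) :=
  LebesgueSpace.Pack (LebesgueSpace.Class
    (isFinLebesgue.Build d T R mu +oo%E (leey 1) cls finite_norm_cls)).

Lemma Linfty_classE : (Linfty_class : T -> R) = f %[ae mu].
Proof. exact: ae_mfun_class. Qed.

End Linfty_class.
End Linfty_classes.

Definition central_difference (R : realType) (h : R) (g : R -> R) : R -> R :=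
  fun x => (g (x + h) - g (x - h)) / (2 * h).

Section central_difference_operator.
Context {R : realType}.
Variables (h : R) (g : Linfty R).
Local Notation mu := (@lebesgue_measure R).

Lemma measurable_central_difference :
  measurable_fun [set: measurableTypeR R]
    (central_difference h g : measurableTypeR R -> measurableTypeR R).
Proof.
have mg : @measurable_fun _ _ R R setT (g : R -> R).
  exact: (@measurable_funPT _ _ (measurableTypeR R) (measurableTypeR R)
    (repr (g : {mfun_ mu, measurableTypeR R >-> measurableTypeR R}))).
have mt c : @measurable_fun _ _ R R setT (fun x => x + c).
  apply: continuous_measurable_fun => x.
  by apply: cvgD => //; exact: cvg_cst.
apply: (@measurable_funM _ R R) => //.
by apply: measurable_funB; apply: measurableT_comp.
Qed.

Lemma finite_norm_central_difference :
  finite_norm mu +oo%E (central_difference h g).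
Proof.
have mu0 : (0 < mu [set: R])%E.
  by rewrite -set_itvNyy lebesgue_measure_itv/= addye// ltry.
have := Lebesgue_finite (s := g); rewrite /finite_norm unlock mu0.
set N := ess_sup _ _ => Noo.
have gN : \forall x \ae mu, (`|g x|%:E <= N)%E := ess_sup_ge mu _.
have N0 : (0 <= N)%E by apply: ess_sup_gee => //; apply: nearW => x /=.
have Nfin : N \is a fin_num by rewrite ge0_fin_numE.
apply: (@le_lt_trans _ _ ((fine N + fine N) * `|(2 * h)^-1|)%:E); last first.
  exact: ltry.
apply/ess_supP; near=> x => /=.
rewrite lee_fin /central_difference normrM ler_wpM2r//.
rewrite (le_trans (ler_normB _ _))// lerD// -lee_fin fineK//; near: x.
  exact: (@ae_translate R h (fun y => (`|g y|%:E <= N)%E)).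
exact: (@ae_translate R (- h) (fun y => (`|g y|%:E <= N)%E)).
Unshelve. all: by end_near. Qed.

Definition central_difference_Linfty : Linfty R :=
  Linfty_class measurable_central_difference finite_norm_central_difference.

(* The class does not depend on the representative [f] of [g]. *)
Lemma central_difference_LinftyE (f : R -> R) : (g : R -> R) = f %[ae mu] ->
  (central_difference_Linfty : R -> R) = central_difference h f %[ae mu].
Proof.
move=> /ae_eq_setT gf; apply: ae_eq_trans (Linfty_classE _ _) _.
near=> x => _; rewrite /central_difference; congr ((_ - _) / _); near: x.
  exact: (@ae_translate R h (fun y => g y = f y)).
exact: (@ae_translate R (- h) (fun y => g y = f y)).
Unshelve. all: by end_near. Qed.

End central_difference_operator.

Definition C2 (R : realType) (f : R -> R) : Prop :=
  [/\ forall x, derivable f x 1, forall x, derivable f^`()%classic x 1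
    & continuous f^`(2)%classic].

Definition Kset (R : realType) (delta m2 : R) (fdelta : Linfty R) :
    set (R -> R) :=
  [set f | [/\ C2 f, (normLinfty f^`(2)%classic <= m2%:E)%E
             & (normLinfty (fun x => f x - fdelta x)%R <= delta%:E)%E]].

Definition step (R : realType) (delta m2 : R) : R :=
  Num.sqrt (2 * delta / m2).

Definition Ldelta (R : realType) (delta m2 : R) : Linfty R -> Linfty R :=
  central_difference_Linfty (step delta m2).

Definition worst_error (R : realType) (delta m2 : R)
    (T : Linfty R -> Linfty R) : \bar R :=
  ereal_sup [set normLinfty (fun x => T p.2 x - p.1^`()%classic x) |
             p in [set p : (R -> R) * Linfty R | Kset delta m2 p.2 p.1]].

Definition gamma2 (R : realType) (delta m2 : R) : \bar R :=
  ereal_inf (range (@worst_error R delta m2)).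

(* Main.v *)
(* Upper bound: by Taylor's formula the central difference of [f] is within
   m2 h / 2 of f', and replacing [f] by the noisy data changes it by at most
   delta / h; for h = sqrt (2 delta / m2) both terms are sqrt (2 delta m2) / 2.

   Lower bound: if f and -f both lie in K(delta, m2) for the data 0, then no
   operator has error below |f'|. The extremal f is delta phi(x / h), with phi
   odd, phi' = psi = 2 max(1 - |x|, 0), hence |phi| <= 1 and |phi''| <= 2. It
   is not C^2, so phi is averaged over [x - e, x + e]: the average is the
   central difference of a primitive of phi, it is C^2 with the same bounds,
   and its derivative at 0 is 2 - e. *)
Require Import Defs.
From mathcomp Require Import all_boot all_order all_algebra.
From mathcomp Require Import all_classical all_reals all_analysis.
From mathcomp Require Import measurable_realfun ess_sup_inf ring lra.

Import Order.TTheory GRing.Theory Num.Theory.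
Import numFieldNormedType.Exports.
Local Open Scope classical_set_scope.
Local Open Scope ring_scope.

(* The library's filter hint fails on [@lebesgue_measure R] over [R] itself. *)
#[local] Instance ae_lebesgue_filter (R : realType) :
  Filter (nbhs (almost_everywhere (@lebesgue_measure R))).
Proof. exact: (@ae_filter_ringOfSetsType _ (measurableTypeR R)). Qed.

(** * Essential bounds and pointwise bounds *)

Lemma normLinfty_leP (R : realType) (f : R -> R) (c : R) :
  (normLinfty f <= c%:E)%E <-> \forall x \ae @lebesgue_measure R, `|f x| <= c.
Proof.
have mu0 : (0 < @lebesgue_measure R [set: R])%E.
  by rewrite -set_itvNyy lebesgue_measure_itv/= addye// ltry.
rewrite /normLinfty unlock mu0.
by split => [/ess_supP H|H]; [exact: H|apply/ess_supP; exact: H].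
Qed.

(** A point where [f] exceeds [c] would have a whole ball of such points, of positive measure,
    inside the null exceptional set. *)
Lemma ae_le_continuous (R : realType) (f : R -> R) (c : R) : continuous f ->
  (\forall x \ae @lebesgue_measure R, f x <= c) -> forall x, f x <= c.
Proof.
move=> cf [N [mN N0 fN]] x; rewrite leNgt; apply/negP => cfx.
have [e /= e0 xe] : \forall y \near x, c < f y.
  exact: (cf x _ (open_nbhs_nbhs (conj (@open_gt R c) cfx))).
have : (@lebesgue_measure R (ball x e) <= @lebesgue_measure R N)%E.
  apply: le_measure; rewrite ?inE//; first exact: measurable_ball.
  by move=> y xy; apply: fN => /=; apply/negP; rewrite -ltNge; exact: xe.
rewrite N0 lebesgue_measure_ball ?(ltW e0)// lee_fin leNgt => /negP; apply.
by rewrite pmulrn_lgt0.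
Qed.

(** * Taylor estimate for the central difference *)

Lemma is_derive1_shift (R : realType) (f df : R -> R) (c x : R) :
  (forall y : R, is_derive y 1 f (df y)) ->
  is_derive x 1 (fun y => f (y + c)) (df (x + c)).
Proof.
move=> fdf; rewrite -[df _]mulr1.
apply: (@is_derive1_comp _ f (fun y => y + c)) => //.
by apply: is_derive_eq; rewrite addr0.
Qed.

Lemma is_derive1_continuous (R : realType) (f df : R -> R) :
  (forall x : R, is_derive x 1 f (df x)) -> continuous f.
Proof.
move=> fdf x; apply/differentiable_continuous/derivable1_diffP.
by case: (fdf x).
Qed.

Lemma lipschitz_is_derive1 (R : realType) (f df : R -> R) (M : R) :
  (forall x : R, is_derive x 1 f (df x)) -> (forall x, `|df x| <= M) ->
  forall x y, x <= y -> `|f y - f x| <= M * (y - x).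
Proof.
move=> fdf dfM x y xy.
have [|c _ ->] := @MVT_segment _ f df x y xy (fun z _ => fdf z).
  exact/continuous_subspaceT/is_derive1_continuous.
by rewrite normrM (ger0_norm (_ : 0 <= y - x)) ?subr_ge0// ler_wpM2r// subr_ge0.
Qed.

Lemma is_derive_central_difference (R : realType) (f df : R -> R) (e : R) :
  (forall x : R, is_derive x 1 f (df x)) ->
  forall x : R,
    is_derive x 1 (central_difference e f) (central_difference e df x).
Proof.
move=> fdf x; rewrite /central_difference.
have h1 := @is_derive1_shift R f df e x fdf.
have h2 := @is_derive1_shift R f df (- e) x fdf.
by apply: is_derive_eq; rewrite /GRing.scale/=; ring.
Qed.

Lemma central_difference_error (R : realType) (f f1 f2 : R -> R) (m h x : R) :
  (forall x : R, is_derive x 1 f (f1 x)) ->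
  (forall x : R, is_derive x 1 f1 (f2 x)) ->
  (forall x, `|f2 x| <= m) -> 0 < h ->
  `|central_difference h f x - f1 x| <= m * h / 2.
Proof.
move=> ff1 f12 f2m h0.
have rem (g g1 : R -> R) : (forall x : R, is_derive x 1 g (g1 x)) ->
    (forall x y, x <= y -> `|g1 y - g1 x| <= m * (y - x)) ->
    g (x + h) - g (x - h) - 2 * h * g1 x <= m * h ^+ 2.
  move=> gg1 g1m.
  (* The derivative of [k] is (g1(x+t) - g1(x)) - (g1(x) - g1(x-t)) - 2mt, which the Lipschitz bound
     makes nonpositive for t >= 0; as k(0) = 0, k(h) <= 0 is the claim. *)
  pose k (t : R) := g (x + t) - g (x - t) - 2 * t * g1 x - m * t ^+ 2.
  have kd (t : R) :
      is_derive t 1 k (g1 (x + t) + g1 (x - t) - 2 * g1 x - m * (2 * t)).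
    have h1 : is_derive t 1 (fun t => g (x + t)) (g1 (x + t)).
      rewrite -[g1 _]mulr1.
      apply: (@is_derive1_comp _ g (fun t : R => x + t)) => //.
      by apply: is_derive_eq; rewrite add0r mul1r.
    have h2 : is_derive t 1 (fun t => g (x - t)) (- g1 (x - t)).
      rewrite -mulrN1; apply: (@is_derive1_comp _ g (fun t : R => x - t)) => //.
      by apply: is_derive_eq; rewrite add0r mul1r.
    by rewrite /k; apply: is_derive_eq; rewrite /GRing.scale/=; ring.
  have : k h <= k 0.
    apply: (@ler0_derive1_nincr _ k 0 h) => //; last exact: ltW.
    - move=> t; rewrite in_itv/= => /andP[t0 _]; rewrite derive1E.
      rewrite (@derive_val _ _ _ _ _ _ _ (kd t)).
      have /ler_normlP[] := g1m x (x + t) ltac:(lra).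
      have /ler_normlP[] := g1m (x - t) x ltac:(lra).
      lra.
    - exact/continuous_subspaceT/is_derive1_continuous.
  by rewrite /k addr0 subr0; lra.
have f1m := @lipschitz_is_derive1 R f1 f2 m f12 f2m.
have up := rem f f1 ff1 f1m.
(* The one-sided estimate for -f supplies the opposite inequality; dividing by 2h then turns m h^2
   into m h / 2. *)
have dn : - f (x + h) - - f (x - h) - 2 * h * - f1 x <= m * h ^+ 2.
  apply: (rem (fun x => - f x) (fun x => - f1 x)) => y z yz.
  by rewrite -opprD normrN f1m.
have -> : central_difference h f x - f1 x =
    (f (x + h) - f (x - h) - 2 * h * f1 x) / (2 * h).
  by rewrite /central_difference; field; rewrite gt_eqF.
rewrite normrM normfV (gtr0_norm (_ : 0 < 2 * h)) ?mulr_gt0//.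
rewrite ler_pdivrMr ?mulr_gt0//.
by rewrite ler_norml; apply/andP; split; lra.
Qed.

(** * Calculus for the extremal function *)

(** Away from 0 the function is locally y^2 or -y^2; at 0 its difference quotient is |h|, which
    tends to 0. *)
Lemma is_derive_mul_norm (R : realType) (x : R) :
  is_derive x 1 (fun y : R => y * `|y|) (2 * `|x|).
Proof.
have [x0|x0|->] := ltgtP x 0.
- apply: (@near_eq_is_derive _ _ _ (fun y : R => - (y ^+ 2))).
    near=> y; rewrite ltr0_norm ?mulrN ?expr2//.
    by near: y; exact: (@lt_nbhsl _ x 0).
  by apply: is_derive_eq; rewrite ltr0_norm// /GRing.scale/=; ring.
- apply: (@near_eq_is_derive _ _ _ (fun y : R => y ^+ 2)).
    near=> y; rewrite gtr0_norm ?expr2//.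
    by near: y; exact: (@lt_nbhsr _ 0 x).
  by apply: is_derive_eq; rewrite gtr0_norm// /GRing.scale/=; ring.
have cv : (fun h : R => h^-1 *: (((fun y : R => y * `|y|) \o shift 0) (h *: 1)
    - (fun y : R => y * `|y|) 0)) @ 0^' --> (0 : R).
  have : (fun h : R => `|h|) @ 0^' --> (0 : R).
    rewrite -[X in _ --> X](normr0 R); apply: cvg_within_filter.
    exact: norm_continuous.
  apply: cvg_trans; apply: near_eq_cvg; near=> h.
  rewrite /= /shift /= addr0 mul0r subr0 scaler1 /GRing.scale/= mulKf//.
  by near: h; exact: nbhs_dnbhs_neq.
apply: DeriveDef; first by apply/cvg_ex; exists 0.
by rewrite normr0 mulr0; exact: cvg_lim cv.
Unshelve. all: by end_near. Qed.

Definition second_difference (R : realType) (f : R -> R) (x : R) : R :=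
  f (x + 1) + f (x - 1) - 2 * f x.

Lemma is_derive_second_difference (R : realType) (f df : R -> R) :
  (forall x : R, is_derive x 1 f (df x)) ->
  forall x : R,
    is_derive x 1 (second_difference R f) (second_difference R df x).
Proof.
move=> fdf x; rewrite /second_difference.
have h1 := @is_derive1_shift R f df 1 x fdf.
have h2 := @is_derive1_shift R f df (- 1) x fdf.
by apply: is_derive_eq; rewrite /GRing.scale/=; ring.
Qed.

Lemma C2_is_derive (R : realType) (f f1 f2 : R -> R) :
  (forall x : R, is_derive x 1 f (f1 x)) ->
  (forall x : R, is_derive x 1 f1 (f2 x)) ->
  continuous f2 -> [/\ C2 f, f^`()%classic = f1 & f^`(2)%classic = f2].
Proof.
move=> ff1 f12 cf2.
have e1 : f^`()%classic = f1.
  by apply/funext => x; rewrite derive1E; exact: derive_val.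
have e2 : f^`(2)%classic = f2.
  rewrite derive1Sn e1 derive1n1; apply/funext => x; rewrite derive1E.
  exact: derive_val.
split => //; split; rewrite ?e1 ?e2//.
Qed.

Lemma is_derive_C2 (R : realType) (f : R -> R) : C2 f ->
  (forall x : R, is_derive x 1 f (f^`()%classic x)) /\
  (forall x : R, is_derive x 1 f^`()%classic (f^`(2)%classic x)).
Proof.
case=> df df1 _; split=> x; rewrite ?derive1Sn ?derive1n1.
  by rewrite [X in is_derive _ _ _ X]derive1E; apply: DeriveDef.
by rewrite [X in is_derive _ _ _ X]derive1E; apply: DeriveDef.
Qed.

(** The numerator is an increment over an interval of length 2e. This carries Lipschitz bounds for
    [Phi] and [psi] over to sup bounds for the smoothed function and its second derivative. *)
Lemma central_difference_le (R : realType) (f : R -> R) (e M : R) : 0 < e ->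
  (forall x y, x <= y -> `|f y - f x| <= M * (y - x)) ->
  forall x, `|central_difference e f x| <= M.
Proof.
move=> e0 fM x; rewrite /central_difference normrM normfV.
rewrite (gtr0_norm (_ : 0 < 2 * e)) ?mulr_gt0// ler_pdivrMr ?mulr_gt0//.
by apply: le_trans (fM _ _ _) _; lra.
Qed.

(** * The smoothed extremal function *)

Section extremal.
Context {R : realType}.

(* [psi] is the hat function 2 max(1 - |x|, 0), a second difference of |x|;
   integrating |x| gives its primitives [phi] and [Phi]. *)
Let Phi (x : R) := second_difference R (fun x => x * (x * `|x|)) x / 6.
Let phi (x : R) := second_difference R (fun x => x * `|x|) x / 2.
Let psi (x : R) := second_difference R (fun x => `|x|) x.

Let Phi_phi (x : R) : is_derive x 1 Phi (phi x).
Proof.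
have H (y : R) : is_derive y 1 (fun x => x * (x * `|x|)) (3 * (y * `|y|)).
  have h := is_derive_mul_norm R y.
  by apply: is_derive_eq; rewrite /GRing.scale/=; ring.
have h := is_derive_second_difference R _ _ H x.
rewrite /Phi; apply: is_derive_eq.
by rewrite /phi /second_difference /GRing.scale/=; field.
Qed.

Let phi_psi (x : R) : is_derive x 1 phi (psi x).
Proof.
have h := is_derive_second_difference R _ _ (is_derive_mul_norm R) x.
rewrite /phi; apply: is_derive_eq.
by rewrite /psi /second_difference /GRing.scale/=; field.
Qed.

(** The disjunctive form lets a case analysis remove every absolute value, leaving linear goals for
    [psi] and quadratic ones for [phi]. *)
Let normP (x : R) : (0 <= x /\ `|x| = x) \/ (x <= 0 /\ `|x| = - x).
Proof.
case: (leP 0 x) => [x0|/ltW x0]; first by left; rewrite ger0_norm.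
by right; rewrite ler0_norm.
Qed.

(** The hat has slopes 0, 2 and -2; this bound stands in for one on phi'', which does not exist at
    the kinks -1, 0, 1. *)
Let psi_lipschitz x y : x <= y -> `|psi y - psi x| <= 2 * (y - x).
Proof.
move=> xy; rewrite /psi /second_difference ler_norml.
by case: (normP x) => -[? ->]; case: (normP y) => -[? ->];
  case: (normP (x + 1)) => -[? ->]; case: (normP (y + 1)) => -[? ->];
  case: (normP (x - 1)) => -[? ->]; case: (normP (y - 1)) => -[? ->];
  apply/andP; split; lra.
Qed.

Let phi_le1 x : `|phi x| <= 1.
Proof.
rewrite /phi /second_difference ler_norml.
by case: (normP x) => -[? ->];
  case: (normP (x + 1)) => -[? ->];
  case: (normP (x - 1)) => -[? ->];
  apply/andP; split; nra.
Qed.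

Let continuous_psi : continuous psi.
Proof.
move=> x; apply: cvgB; first apply: cvgD.
- apply: cvg_norm; apply: cvgD => //; exact: cvg_cst.
- apply: cvg_norm; apply: cvgD => //; exact: cvg_cst.
- apply: cvgM; [exact: cvg_cst | exact: norm_continuous].
Qed.

Lemma C2_extremal (delta h e : R) : 0 < delta -> 0 < h -> 0 < e < 1 ->
  exists f : R -> R,
  [/\ C2 f, forall x, `|f x| <= delta,
      forall x, `|f^`(2)%classic x| <= 2 * delta / h ^+ 2 &
      f^`()%classic 0 = 2 * delta / h * (1 - e / 2)].
Proof.
move=> d0 h0 /andP[e0 e1].
(* The witness is [delta] times the central difference of [Phi] at x / h. Each derivative passes
   through the central difference and costs a factor 1 / h; two uses lead from [Phi] to [phi] to
   [psi]. *)
have sc (g dg : R -> R) (c : R)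
    (gdg : forall x : R, is_derive x 1 g (dg x)) (x : R) :
    is_derive x 1 (fun x : R => c * central_difference e g (x / h))
      (c / h * central_difference e dg (x / h)).
  have H : is_derive x 1 (fun x : R => central_difference e g (x / h))
      (central_difference e dg (x / h) / h).
    apply: (@is_derive1_comp _ (central_difference e g) (fun x => x / h)).
      exact: is_derive_central_difference.
    by apply: is_derive_eq; rewrite scaler0 add0r /GRing.scale/= mulr1.
  by apply: is_derive_eq; rewrite /GRing.scale/=; ring.
have [] := C2_is_derive R _ _ _ (sc Phi phi delta Phi_phi)
  (sc phi psi (delta / h) phi_psi).
  move=> x; apply: cvgM; first exact: cvg_cst.
  apply: cvgM; last exact: cvg_cst.
  have cxh c : (fun x : R => x / h + c) @ x --> x / h + c.
    apply: cvgD; last exact: cvg_cst.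
    by apply: cvgM => //; exact: cvg_cst.
  by apply: cvgB; apply: (cvg_comp _ _ (cxh _)); exact: continuous_psi.
move=> C2f f1E f2E; eexists; split; [exact: C2f|move=> x|move=> x|].
- rewrite normrM (gtr0_norm d0) ler_piMr ?(ltW d0)//.
  apply: (central_difference_le R Phi e 1 e0).
  exact: (lipschitz_is_derive1 R Phi phi).
- rewrite f2E normrM gtr0_norm ?divr_gt0//.
  have := central_difference_le R psi e 2 e0 psi_lipschitz (x / h) => H.
  have -> : 2 * delta / h ^+ 2 = delta / h / h * 2.
    by field; rewrite gt_eqF.
  by rewrite ler_pM2l// !divr_gt0.
(* Since e < 1, [phi] at e and -e equals 2e - e^2 and its opposite, so the quotient is 2 - e. *)
- rewrite f1E mul0r /central_difference /phi /second_difference !add0r !normrN.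
  rewrite (gtr0_norm e0) (gtr0_norm (_ : 0 < e + 1)); last lra.
  rewrite (ltr0_norm (_ : e - 1 < 0)); last lra.
  rewrite (gtr0_norm (_ : 0 < - e + 1)); last lra.
  rewrite (ltr0_norm (_ : - e - 1 < 0)); last lra.
  by field; rewrite !gt_eqF.
Qed.

End extremal.

(** * The two bounds on the worst error *)

Lemma Linfty_zero (R : realType) :
  exists g : Linfty R, \forall x \ae @lebesgue_measure R, g x = 0.
Proof.
have m0 : measurable_fun [set: measurableTypeR R]
  (fun=> 0 : measurableTypeR R) by exact: measurable_cst.
have f0 : finite_norm (@lebesgue_measure R) +oo%E (fun=> 0 : R).
  apply: (@le_lt_trans _ _ (0 : R)%:E); last exact: ltry.
  by apply/normLinfty_leP; apply: aeW => x; rewrite normr0.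
exists (Linfty_class m0 f0).
exact: ae_eq_setT (Linfty_classE m0 f0).
Qed.

Lemma worst_error_Ldelta_le (R : realType) (delta m2 : R) :
  0 < delta -> 0 < m2 ->
  (worst_error delta m2 (Ldelta delta m2) <= (Num.sqrt (2 * delta * m2))%:E)%E.
Proof.
move=> d0 m0; apply: ge_ereal_sup => _ [[f g] /= [C2f f2m fg] <-].
have [ff1 f12] := is_derive_C2 R f C2f.
(* Continuity of f'' makes its essential bound hold everywhere, as the Taylor estimate requires. *)
have {}f2m : forall x, `|f^`(2)%classic x| <= m2.
  apply: ae_le_continuous => [x|]; last exact/normLinfty_leP.
  by apply: cvg_norm; case: C2f => _ _; exact.
move/normLinfty_leP : fg => fg.
set h := step delta m2.
have h0 : 0 < h by rewrite sqrtr_gt0 divr_gt0 ?mulr_gt0.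
have h2 : h ^+ 2 * m2 = 2 * delta.
  by rewrite sqr_sqrtr ?divfK ?gt_eqF// ltW// divr_gt0 ?mulr_gt0.
have -> : Num.sqrt (2 * delta * m2) = m2 * h.
  rewrite -h2 -mulrA -expr2 -exprMn sqrtr_sqr mulrC ger0_norm// mulr_ge0//.
    exact: ltW.
  exact: ltW.
(* The representative of the class [Ldelta delta m2 g] agrees with the central difference of [g]
   only almost everywhere. *)
have E := ae_eq_setT
  (@central_difference_LinftyE R h g g (aeW _ (fun _ _ => erefl))).
have gp : \forall x \ae @lebesgue_measure R,
    `|f (x + h) - g (x + h)| <= delta :=
  @ae_translate R h (fun x => `|f x - g x| <= delta) fg.
have gm : \forall x \ae @lebesgue_measure R,
    `|f (x - h) - g (x - h)| <= delta :=
  @ae_translate R (- h) (fun x => `|f x - g x| <= delta) fg.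
apply/normLinfty_leP; near=> x.
have -> : Ldelta delta m2 g x = central_difference h g x by near: x.
have /ler_normlP[] := central_difference_error R f _ _ m2 h x ff1 f12 f2m h0.
have : `|f (x + h) - g (x + h)| <= delta by near: x.
have : `|f (x - h) - g (x - h)| <= delta by near: x.
move=> /ler_normlP[a1 a2] /ler_normlP[b1 b2] c1 c2.
(* The noise contributes at most 2 delta / (2h), which is m2 h / 2 by [h2]. *)
have : `|central_difference h g x - central_difference h f x| <= m2 * h / 2.
  rewrite /central_difference -mulrBl normrM normfV.
  rewrite (gtr0_norm (_ : 0 < 2 * h)) ?mulr_gt0// ler_pdivrMr ?mulr_gt0//.
  by rewrite ler_norml; apply/andP; split; lra.
by move=> /ler_normlP[k1 k2]; rewrite ler_norml; apply/andP; split; lra.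
Unshelve. all: by end_near. Qed.

(** With zero data, [T g] is within [w] of both f' and -f', so 2 f' <= 2 w almost everywhere;
    continuity of f' extends this to every point, in particular to 0. *)
Lemma derive1_le_worst_error (R : realType) (delta m2 w : R)
    (T : Linfty R -> Linfty R) (f : R -> R) :
  C2 f -> (forall x, `|f x| <= delta) ->
  (forall x, `|f^`(2)%classic x| <= m2) ->
  (worst_error delta m2 T <= w%:E)%E -> forall x, f^`()%classic x <= w.
Proof.
move=> C2f fd f2m Tw.
have [g g0] := Linfty_zero R.
have err (k : R -> R) : C2 k -> (forall x, `|k x| <= delta) ->
    (forall x, `|k^`(2)%classic x| <= m2) ->
    \forall x \ae @lebesgue_measure R, `|T g x - k^`()%classic x| <= w.
  move=> C2k kd k2m; apply/normLinfty_leP; apply: le_trans Tw.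
  apply: ereal_sup_ubound; exists (k, g) => //=; split => //.
    by apply/normLinfty_leP; exact: aeW.
  apply/normLinfty_leP; near=> x.
  have -> : g x = 0 by near: x.
  by rewrite subr0.
have [ff1 f12] := is_derive_C2 R f C2f.
have [|C2Nf Nf1 Nf2] := C2_is_derive R (fun x => - f x)
  (fun x => - f^`()%classic x) (fun x => - f^`(2)%classic x).
  by move=> x; apply: cvgN; case: C2f => _ _; exact.
have fw := err f C2f fd f2m.
have Nfw : \forall x \ae @lebesgue_measure R, `|T g x + f^`()%classic x| <= w.
  have := err _ C2Nf; rewrite Nf1 Nf2 => H.
  apply: filterS (H _ _) => [x|x|x]; by rewrite ?opprK ?normrN.
apply: ae_le_continuous; first exact: is_derive1_continuous f12.
near=> x.
have /ler_normlP[a1 a2] : `|T g x - f^`()%classic x| <= w by near: x.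
have /ler_normlP[b1 b2] : `|T g x + f^`()%classic x| <= w by near: x.
lra.
Unshelve. all: by end_near. Qed.

Lemma worst_error_ge (R : realType) (delta m2 : R) (T : Linfty R -> Linfty R) :
  0 < delta -> 0 < m2 ->
  ((Num.sqrt (2 * delta * m2))%:E <= worst_error delta m2 T)%E.
Proof.
move=> d0 m0; set s := Num.sqrt _.
have s0 : 0 < s by rewrite sqrtr_gt0 !mulr_gt0.
have s2 : s ^+ 2 = 2 * delta * m2 by rewrite sqr_sqrtr// ltW// !mulr_gt0.
have key w : (worst_error delta m2 T <= w%:E)%E -> s <= w.
  move=> Tw; rewrite leNgt; apply/negP => ws.
  (* The extremal slope at 0 will be s (1 - e / 2). Taking e s <= s - w keeps it above [w], and the
     cap 1 / 2 ensures e < 1. *)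
  pose e := Num.min (1 / 2) ((s - w) / s).
  have e0 : 0 < e by rewrite lt_min !divr_gt0// subr_gt0.
  have e12 : e <= 1 / 2 by rewrite ge_min lexx.
  have es : e * s <= s - w by rewrite -ler_pdivlMr// ge_min lexx orbT.
  (* The scale s / m2 equals [step delta m2]; it makes 2 delta / h equal to [s] and 2 delta / h^2
     equal to [m2]. *)
  have [|f [C2f fd f2m f1]] := C2_extremal delta (s / m2) e d0 (divr_gt0 s0 m0).
    by rewrite e0; lra.
  have := derive1_le_worst_error R delta m2 w T f C2f fd _ Tw 0.
  rewrite f1 (_ : 2 * delta / (s / m2) = s); last first.
    by apply/eqP; rewrite invf_div mulrA -s2 expr2 mulfK// gt_eqF.
  have m2E : 2 * delta / (s / m2) ^+ 2 = m2.
    rewrite expr_div_n s2; field; rewrite !gt_eqF//.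
  rewrite m2E in f2m; move=> /(_ f2m); lra.
case E : (worst_error delta m2 T) => [r| |]; rewrite ?leey//.
  by rewrite lee_fin key// E.
(* A worst error of -oo would lie below s - 1, and [key] would give s <= s - 1. *)
have := key (s - 1); rewrite E leNye => /(_ isT).
by rewrite lerBrDr gerDl ler10.
Qed.

Theorem corollary2p1 (R : realType) (delta m2 : R) (hdelta : 0 < delta)
    (hm2 : 0 < m2) :
  gamma2 delta m2 = (Num.sqrt (2 * delta * m2))%:E /\
  worst_error delta m2 (Ldelta delta m2) = gamma2 delta m2.
Proof.
have le_gamma : ((Num.sqrt (2 * delta * m2))%:E <= gamma2 delta m2)%E.
  by apply/ereal_infP => _ [T _ <-]; exact: worst_error_ge.
have gamma_le : (gamma2 delta m2 <= worst_error delta m2 (Ldelta delta m2))%E.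
  by apply: ereal_inf_lbound; exists (Ldelta delta m2).
have worst_le := worst_error_Ldelta_le R delta m2 hdelta hm2.
split; apply/le_anti/andP; split => //.
  exact: le_trans worst_le.
exact: le_trans le_gamma.
Qed.
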